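(* Let $K\subset\mathbb{R}^3$ be a (nondegenerate) tetrahedron and let $$\Sigma_K=\{\,\sigma\in\mathcal{P}_2(K;\mathbb{S})\ :\ (Q_{s_e}\sigma Q_{s_e})|_e\in\mathcal{P}_1(e;\mathbb{S})\ \text{for all } e\in\Delta_1(K)\,\}.$$ Then the degrees of freedom $$\int_f \sigma n_f\cdot v\,ds,\quad v\in\mathcal{P}_1(f;\mathbb{R}^3),\ f\in\Delta_2(K),\qquad\text{and}\qquad \int_K\sigma\,dx$$ are unisolvent for $\Sigma_K$: if $\sigma\in\Sigma_K$ satisfies $\int_f\sigma n_f\cdot v\,ds=0$ for all $f\in\Delta_2(K)$ and all $v\in\mathcal{P}_1(f;\mathbb{R}^3)$, and $\int_K\sigma\,dx=0$, then $\sigma=0$.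
   Context: $\mathbb{S}$ is the space of symmetric $3\times3$ real matrices. For a set $T$ (a simplex) and a finite-dimensional vector space $X$, $\mathcal{P}_k(T;X)$ is the space of $X$-valued polynomial functions on $T$ of degree at most $k$. $\Delta_k(K)$ is the set of $k$-dimensional subsimplices of $K$ ($\Delta_1(K)$ = edges, $\Delta_2(K)$ = faces). For an edge $e$, $s_e$ is a unit vector parallel to $e$; for a face $f$, $n_f$ is the outward unit normal to $f$. For a unit vector $u\in\mathbb{R}^3$, $Q_u=I-uu'$ is the matrix of the orthogonal projection of $\mathbb{R}^3$ onto the plane $u^\perp$ (the prime denotes transpose). The integral $\int_K\sigma\,dx$ is taken componentwise (an element of $\mathbb{S}$). *)

(* Defs.v *)
From mathcomp Require Import all_boot all_order all_algebra.
From mathcomp Require Import all_classical all_reals all_analysis.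
(* The notations of mpoly clash with those of MathComp-Analysis. *)
From mathcomp Require Import -(notations) mpoly.
Set Implicit Arguments.
Unset Strict Implicit.
Unset Printing Implicit Defensive.
Import Order.TTheory GRing.Theory Num.Theory.
Local Open Scope classical_set_scope.
Local Open Scope ring_scope.

(* The canonical norm of MathComp-Analysis on matrices is the sup norm, hence
   the explicit Euclidean structure. *)
Definition dot (R : realType) (u v : 'cV[R]_3) : R := (u^T *m v) 0 0.
Definition norm2 (R : realType) (u : 'cV[R]_3) : R := Num.sqrt (dot u u).

Definition symmetric_matrices (R : realType) : set 'M[R]_3 :=
  [set A | A^T = A].

Definition hull (R : realType) (k : nat) (b : 'I_k -> 'cV[R]_3) :
    set 'cV[R]_3 :=
  [set x | exists w : 'I_k -> R, [/\ forall i, 0 <= w i, \sum_i w i = 1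
                                   & x = \sum_i w i *: b i]].

(* The columns of [spread b] are b_1 - b_0, ..., b_k - b_0. *)
Definition spread (R : realType) (k : nat) (b : 'I_k.+1 -> 'cV[R]_3) :
    'M[R]_(3, k) :=
  \matrix_(i, j) (b (lift ord0 j) - b ord0) i 0.

(* A tetrahedron is given by its four vertices [a]; its face number [i] is the
   one opposite to [a i], and its edges are indexed by the pairs i != j. *)
Definition nondegenerate_tetrahedron (R : realType) (a : 'I_4 -> 'cV[R]_3) : Prop :=
  spread a \in unitmx.
Definition edge (R : realType) (a : 'I_4 -> 'cV[R]_3) (i j : 'I_4) :
    set 'cV[R]_3 :=
  hull (fun l : 'I_2 => if l == ord0 then a i else a j).
Definition face_vertices (R : realType) (a : 'I_4 -> 'cV[R]_3) (i : 'I_4) :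
    'I_3 -> 'cV[R]_3 :=
  fun l => a (lift i l).
Definition face (R : realType) (a : 'I_4 -> 'cV[R]_3) (i : 'I_4) :
    set 'cV[R]_3 :=
  hull (face_vertices a i).

Definition edge_tangent (R : realType) (a : 'I_4 -> 'cV[R]_3) (i j : 'I_4) :
    'cV[R]_3 :=
  (norm2 (a j - a i))^-1 *: (a j - a i).

Definition is_outward_unit_normal (R : realType) (a : 'I_4 -> 'cV[R]_3)
    (i : 'I_4) (n : 'cV[R]_3) : Prop :=
  [/\ norm2 n = 1,
      forall x y, face a i x -> face a i y -> dot n (x - y) = 0
    & forall x, face a i x -> dot n (a i - x) < 0].

Definition Qproj (R : realType) (u : 'cV[R]_3) : 'M[R]_3 := 1%:M - u *m u^T.

(* P_k(T; X), for T a subset of R^3 and X a linear subspace of the space of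
   m x n matrices (X = setT, n = 1 for R^m-valued functions).  Its members are
   represented by total functions, of which only the values on T matter.
   On a lower-dimensional T, the polynomials on T are exactly the restrictions
   of the polynomials on R^3.  The degree of a multivariate polynomial [p] is
   [(msize p).-1]. *)
Definition polyfun (R : realType) (k : nat) (T : set 'cV[R]_3) (m n : nat)
    (X : set 'M[R]_(m, n)) : set ('cV[R]_3 -> 'M[R]_(m, n)) :=
  [set f | (forall x, T x -> X (f x)) /\
     exists P : 'I_m -> 'I_n -> mpoly 3 R,
       (forall i j, (msize (P i j) <= k.+1)%N) /\
       (forall x, T x ->
          f x = \matrix_(i, j) meval (fun l => x l 0) (P i j))].

Definition Sigma (R : realType) (a : 'I_4 -> 'cV[R]_3) :
    set ('cV[R]_3 -> 'M[R]_3) :=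
  [set sigma |
     polyfun 2 (hull a) (@symmetric_matrices R) sigma /\
     forall i j : 'I_4, i != j ->
       polyfun 1 (edge a i j) (@symmetric_matrices R)
         (fun x => Qproj (edge_tangent a i j) *m sigma x
                     *m Qproj (edge_tangent a i j))].

Definition reference_triangle (R : realType) : set (R * R) :=
  [set p | [/\ 0 <= p.1, 0 <= p.2 & p.1 + p.2 <= 1]].

(* Surface integral over the triangle with vertices [b], by its affine
   parametrization; the area element is the square root of the Gram
   determinant. *)
Definition triangle_integral (R : realType) (b : 'I_3 -> 'cV[R]_3)
    (g : 'cV[R]_3 -> R) : R :=
  Num.sqrt (\det ((spread b)^T *m spread b)) *
  \int[(@lebesgue_measure R \x @lebesgue_measure R)%E]_(p in
      @reference_triangle R)
    g (b ord0 + spread b *m \col_l (if l == ord0 :> 'I_2 then p.1 else p.2)).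

Definition point3 (R : realType) (p : R * R * R) : 'cV[R]_3 :=
  \col_l (if l == 0 :> 'I_3 then p.1.1 else if l == 1 then p.1.2 else p.2).

(* Entrywise integral over a subset of R^3, with respect to the
   three-dimensional Lebesgue measure. *)
Definition volume_integral (R : realType) (K : set 'cV[R]_3) (m n : nat)
    (F : 'cV[R]_3 -> 'M[R]_(m, n)) : 'M[R]_(m, n) :=
  \matrix_(i, j)
    \int[((@lebesgue_measure R \x @lebesgue_measure R)
            \x @lebesgue_measure R)%E]_(p in @point3 R @^-1` K)
      F (point3 p) i j.

(* Main.v *)
Require Import Defs.
From mathcomp Require Import all_boot all_order all_algebra.
From mathcomp Require Import all_classical all_reals all_analysis.
From mathcomp Require Import -(notations) mpoly.
From mathcomp Require Import measurable_realfun zify ring lra.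
Set Implicit Arguments.
Unset Strict Implicit.
Unset Printing Implicit Defensive.
Import Order.TTheory GRing.Theory Num.Theory.
Import numFieldNormedType.Exports.
Local Open Scope classical_set_scope.
Local Open Scope ring_scope.

(** Let [lam i] be the barycentric coordinates of the tetrahedron and [g i]
    their gradients. The gradient [g i] is a multiple of the normal of face [i],
    the four gradients add up to zero and any three of them form a basis. Hence
    a stress is known from its frame entries [q i j = g i . sigma (g j)], even
    from the six off-diagonal ones ([frame_bilinear_eq0]), and it suffices to
    show that those vanish.

    A quadratic function is described by its values [v m] at the vertices and,
    for each edge, by a multiple [c m n] of its second difference along that
    edge, which vanishes when the function is affine there
    ([barycentric_quadratic], [edge_bubble]). The gradients [g i] and [g j] are
    both orthogonal to an edge that avoids the vertices [i] and [j], hence fixed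
    by the projection [Q] of that edge; so the condition defining the space says
    that [q i j] is affine along each such edge: [c i j m n = 0] as soon as [i]
    and [j] are both outside [{m, n}] ([frame_bubble_edge]).

    The face degrees of freedom say that [q i j] is orthogonal to all affine
    functions on face [i], for every [j]. With the exact values of the integrals
    of barycentric monomials this becomes three linear equations between the [v]
    and the [c] of that face ([face_moment_zero]). For distinct [i, j, k, l]:
    - [q i i] is affine on all edges of face [i], so it vanishes on that face;
    - [q i j] is orthogonal to affine functions on the two faces [i] and [j],
      whose equations share the vertex values at [k] and [l]; comparing them
      gives [c i j i k = c i j j k], so that [p i j k := c i j j k] is symmetric
      in [i] and [j];
    - the entries [q i m] add up to zero over [m], which restricted to face [i],
      where [q i i] vanishes, gives [p i j k = - p i k j].

    An array which is symmetric in its first two indices and skew in its last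
    two is zero ([mixed_coef_eq0]). Then the vertex values vanish too and what
    remains is [q i j = c i j i j * lam i * lam j] ([quadratic_off_diagonal]).
    As [lam i * lam j] has positive integral over the tetrahedron, the volume
    degrees of freedom make the last coefficient zero. *)

(** * Euclidean product *)

Lemma dotE (R : realType) (u x : 'cV[R]_3) : dot u x = \sum_k u k 0 * x k 0.
Proof. by rewrite /dot mxE; apply: eq_bigr => k _; rewrite mxE. Qed.

Lemma dotC (R : realType) (u x : 'cV[R]_3) : dot u x = dot x u.
Proof. by rewrite !dotE; apply: eq_bigr => k _; rewrite mulrC. Qed.

Lemma dotBr (R : realType) (u x y : 'cV[R]_3) : dot u (x - y) = dot u x - dot u y.
Proof. by rewrite /dot mulmxBr !mxE. Qed.

Lemma dotZr (R : realType) k (u x : 'cV[R]_3) : dot u (k *: x) = k * dot u x.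
Proof. by rewrite /dot -scalemxAr !mxE. Qed.

Lemma dotZl (R : realType) k (u x : 'cV[R]_3) : dot (k *: u) x = k * dot u x.
Proof. by rewrite dotC dotZr dotC. Qed.

Lemma dot_mulmx (R : realType) (A : 'M[R]_3) (u x : 'cV[R]_3) :
  dot u (A *m x) = dot (A^T *m u) x.
Proof. by rewrite /dot trmx_mul trmxK mulmxA. Qed.

Lemma dot_mulmxE (R : realType) (A : 'M[R]_3) (u x : 'cV[R]_3) :
  dot u (A *m x) = \sum_(k : 'I_3 * 'I_3) u k.1 0 * x k.2 0 * A k.1 k.2.
Proof.
rewrite dotE -(pair_bigA _ (fun k l => u k 0 * x l 0 * A k l))/=.
apply: eq_bigr => k _; rewrite mxE mulr_sumr; apply: eq_bigr => l _.
by rewrite mulrA mulrAC.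
Qed.

Lemma dot_eq0 (R : realType) (u : 'cV[R]_3) : dot u u = 0 -> u = 0.
Proof.
rewrite dotE => /eqP; rewrite psumr_eq0 => [/allP u0|k _]; last first.
  by rewrite -expr2 sqr_ge0.
apply/colP => k; rewrite mxE; apply/eqP.
by have := u0 k; rewrite mem_index_enum mulf_eq0 orbb; exact.
Qed.

(** * Quadratic functions in barycentric form *)

(** A polynomial of degree at most two, as its affine interpolant plus edge
    bubbles. The factor one half compensates for each edge being counted as
    both [(m, n)] and [(n, m)]; the coefficients are used with [c m m = 0]. *)
Definition barycentric_quadratic (R : realFieldType) (I : finType)
    (v : I -> R) (c : I -> I -> R) (w : I -> R) : R :=
  \sum_m v m * w m + 2^-1 * \sum_m \sum_n c m n * (w m * w n).

(** Multiplying the affine part by [\sum_n w n = 1] leaves a single kind of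
    term, so that only products of two coordinates have to be integrated. *)
Lemma quadratic_homogenize (R : realFieldType) (I : finType) (v : I -> R)
    (c : I -> I -> R) (w : I -> R) : \sum_m w m = 1 ->
  barycentric_quadratic v c w =
  \sum_m \sum_n (v m + 2^-1 * c m n) * (w m * w n).
Proof.
move=> w1; rewrite /barycentric_quadratic mulr_sumr -big_split.
apply: eq_bigr => m _ /=.
rewrite -[v m * w m]mulr1 -w1 2!mulr_sumr -big_split; apply: eq_bigr => n _ /=.
ring.
Qed.

(** Affinity and, below, quadraticity are tested on arbitrary finite affine
    combinations: the same statement then serves on edges, faces and the whole
    tetrahedron. *)
Definition affine_fun (R : realType) (f : 'cV[R]_3 -> R) : Prop :=
  forall (I : finType) (b : I -> 'cV[R]_3) (w : I -> R),
    \sum_m w m = 1 -> f (\sum_m w m *: b m) = \sum_m f (b m) * w m.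

(** For a function of degree two, the coefficient of the product of the two
    barycentric coordinates of the segment from [x] to [y]. *)
Definition edge_bubble (R : realType) (f : 'cV[R]_3 -> R) (x y : 'cV[R]_3) : R :=
  4%:R * f (2^-1 *: (x + y)) - 2%:R * f x - 2%:R * f y.

Definition quadratic_fun (R : realType) (f : 'cV[R]_3 -> R) : Prop :=
  forall (I : finType) (b : I -> 'cV[R]_3) (w : I -> R),
    \sum_m w m = 1 ->
    f (\sum_m w m *: b m) = barycentric_quadratic (fun m => f (b m))
      (fun m n => edge_bubble f (b m) (b n)) w.

Lemma affine_cst (R : realType) (k : R) : affine_fun (fun=> k).
Proof. by move=> I b w w1; rewrite -mulr_sumr w1 mulr1. Qed.

Lemma affine_coord (R : realType) (i : 'I_3) :
  affine_fun (fun x : 'cV[R]_3 => x i 0).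
Proof.
move=> I b w w1; rewrite summxE; apply: eq_bigr => m _.
by rewrite mxE mulrC.
Qed.

Lemma affine_add (R : realType) (f g : 'cV[R]_3 -> R) :
  affine_fun f -> affine_fun g -> affine_fun (fun x => f x + g x).
Proof.
move=> Af Ag I b w w1; rewrite Af// Ag// -big_split; apply: eq_bigr => m _.
by rewrite mulrDl.
Qed.

Lemma affine_scale (R : realType) (k : R) (f : 'cV[R]_3 -> R) :
  affine_fun f -> affine_fun (fun x => k * f x).
Proof.
move=> Af I b w w1; rewrite Af// mulr_sumr; apply: eq_bigr => m _.
by rewrite mulrA.
Qed.

Lemma affine_midpoint (R : realType) (f : 'cV[R]_3 -> R) x y :
  affine_fun f -> f (2^-1 *: (x + y)) = 2^-1 * (f x + f y).
Proof.
move=> Af; have := Af bool (fun b => if b then x else y) (fun=> 2^-1).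
rewrite !big_bool /= -scalerDr -mulrDl mulrC; apply; lra.
Qed.

Lemma quadratic_add (R : realType) (f g : 'cV[R]_3 -> R) :
  quadratic_fun f -> quadratic_fun g -> quadratic_fun (fun x => f x + g x).
Proof.
move=> Qf Qg I b w w1; rewrite Qf// Qg// /barycentric_quadratic addrACA -mulrDr.
congr (_ + _ * _); rewrite -big_split; apply: eq_bigr => m _ /=.
  by rewrite mulrDl.
rewrite -big_split; apply: eq_bigr => n _; rewrite /edge_bubble /=.
by ring.
Qed.

Lemma quadratic_scale (R : realType) (k : R) (f : 'cV[R]_3 -> R) :
  quadratic_fun f -> quadratic_fun (fun x => k * f x).
Proof.
move=> Qf I b w w1; rewrite Qf// /barycentric_quadratic mulrDr mulrCA.
congr (_ + _ * _); rewrite mulr_sumr; apply: eq_bigr => m _ /=.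
  by rewrite mulrA.
rewrite mulr_sumr; apply: eq_bigr => n _; rewrite /edge_bubble /=.
by ring.
Qed.

(** The bubble coefficient of [f * g] is [- (f x - f y) * (g x - g y)], so the
    claim is the covariance identity: the mean of a product minus the product of
    the means is half the mean of the product of the pairwise differences. *)
Lemma quadratic_mul_affine (R : realType) (f g : 'cV[R]_3 -> R) :
  affine_fun f -> affine_fun g -> quadratic_fun (fun x => f x * g x).
Proof.
move=> Af Ag I b w w1; rewrite Af// Ag// /barycentric_quadratic.
pose s (h : I -> R) := \sum_m h m * w m.
have sE h1 h2 : s h1 * s h2 = \sum_m \sum_n (h1 m * h2 n) * (w m * w n).
  rewrite /s mulr_suml; apply: eq_bigr => m _; rewrite mulr_sumr.
  by apply: eq_bigr => n _; ring.
pose F m := f (b m); pose G m := g (b m).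
have -> : \sum_m \sum_n edge_bubble (fun x => f x * g x) (b m) (b n)
      * (w m * w n) =
    s F * s G + s G * s F - s (fun m => F m * G m) * s (fun=> 1)
    - s (fun=> 1) * s (fun m => F m * G m).
  rewrite !sE -big_split -2!sumrB; apply: eq_bigr => m _ /=.
  rewrite -big_split -2!sumrB; apply: eq_bigr => n _ /=.
  rewrite /edge_bubble !affine_midpoint// -/(F m) -/(F n) -/(G m) -/(G n).
  by field.
have s1 : s (fun=> 1) = 1 by rewrite /s -mulr_sumr mul1r.
rewrite -/(s F) -/(s G) -/(s (fun m => F m * G m)) s1.
by field.
Qed.

Lemma affine_quadratic (R : realType) (f : 'cV[R]_3 -> R) :
  affine_fun f -> quadratic_fun f.
Proof.
move=> Af; have := quadratic_mul_affine (affine_cst 1) Af.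
by rewrite (_ : (fun x => 1 * f x) = f)//; apply/funext => x; rewrite mul1r.
Qed.

Lemma edge_bubble_affine (R : realType) (f : 'cV[R]_3 -> R) x y :
  affine_fun f -> edge_bubble f x y = 0.
Proof. by move=> Af; rewrite /edge_bubble affine_midpoint// ; field. Qed.

Lemma affine_sum (R : realType) (I : eqType) (s : seq I)
    (f : I -> 'cV[R]_3 -> R) : {in s, forall i, affine_fun (f i)} ->
  affine_fun (fun x => \sum_(i <- s) f i x).
Proof.
elim: s => [|i s IHs] Af.
  rewrite (_ : (fun x => _) = fun=> 0); first exact: affine_cst.
  by apply/funext => x; rewrite big_nil.
rewrite (_ : (fun x => _) = fun x => f i x + \sum_(j <- s) f j x).
  apply: affine_add; first exact/Af/mem_head.
  by apply: IHs => j js; apply: Af; rewrite inE js orbT.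
by apply/funext => x; rewrite big_cons.
Qed.

Lemma quadratic_sum (R : realType) (I : eqType) (s : seq I)
    (f : I -> 'cV[R]_3 -> R) : {in s, forall i, quadratic_fun (f i)} ->
  quadratic_fun (fun x => \sum_(i <- s) f i x).
Proof.
elim: s => [|i s IHs] Qf.
  rewrite (_ : (fun x => _) = fun=> 0); first exact/affine_quadratic/affine_cst.
  by apply/funext => x; rewrite big_nil.
rewrite (_ : (fun x => _) = fun x => f i x + \sum_(j <- s) f j x).
  apply: quadratic_add; first exact/Qf/mem_head.
  by apply: IHs => j js; apply: Qf; rewrite inE js orbT.
by apply/funext => x; rewrite big_cons.
Qed.

Lemma affine_monomial (R : realType) (m : multinom 3) : (mdeg m <= 1)%N ->
  affine_fun (fun x : 'cV[R]_3 => \prod_i x i 0 ^+ m i).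
Proof.
case dm : (mdeg m) => [|[|//]] _.
  move/eqP: dm; rewrite mdeg_eq0 => /eqP ->.
  rewrite (_ : (fun x => _) = fun=> 1); first exact: affine_cst.
  by apply/funext => x; rewrite big1// => i _; rewrite mnm0E.
have /mdeg1P[i /eqP ->] : mdeg m == 1%N by rewrite dm.
rewrite (_ : (fun x => _) = fun x : 'cV[R]_3 => x i 0); first exact: affine_coord.
apply/funext => x; rewrite (bigD1 i)//= mnm1E eqxx expr1 big1 ?mulr1// => j ji.
by rewrite mnm1E eq_sym (negbTE ji).
Qed.

(** A monomial of degree two is a coordinate times a monomial of degree one. *)
Lemma quadratic_monomial (R : realType) (m : multinom 3) : (mdeg m <= 2)%N ->
  quadratic_fun (fun x : 'cV[R]_3 => \prod_i x i 0 ^+ m i).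
Proof.
case: (leqP (mdeg m) 1) => [m1 _|m1 m2].
  exact/affine_quadratic/affine_monomial.
have dm : mdeg m = 2%N by lia.
have [i mi] : exists i, (0 < m i)%N.
  apply/existsP; apply: contraT; rewrite negb_exists => /forallP m0.
  suff : m = mnm0 by move=> m00; rewrite m00 mdeg0 in dm.
  by apply/mnmP => i; rewrite mnm0E; apply/eqP; have := m0 i; rewrite -eqn0Ngt.
have mE : m = mnm_add (mnm1 i) (mnm_sub m (mnm1 i)).
  apply/mnmP => j; rewrite mnmDE mnmBE mnm1E; case: eqP => [<-|]/=; lia.
rewrite (_ : (fun x => _) =
    fun x : 'cV[R]_3 => x i 0 * \prod_j x j 0 ^+ mnm_sub m (mnm1 i) j); last first.
  apply/funext => x; rewrite [in LHS]mE.
  under eq_bigr do rewrite mnmDE exprD.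
  rewrite big_split /=; congr (_ * _).
  rewrite (bigD1 i)//= mnm1E eqxx expr1 big1 ?mulr1// => j ji.
  by rewrite mnm1E eq_sym (negbTE ji).
apply: quadratic_mul_affine; first exact: affine_coord.
by apply: affine_monomial; have := dm; rewrite [in mdeg m]mE mdegD mdeg1; lia.
Qed.

Lemma affine_meval (R : realType) (p : mpoly 3 R) : (msize p <= 2)%N ->
  affine_fun (fun x => meval (fun l => x l 0) p).
Proof.
move=> p2; rewrite (_ : (fun x => _) = fun x : 'cV[R]_3 =>
    \sum_(m <- msupp p) mcoeff m p * \prod_i x i 0 ^+ m i); last first.
  by apply/funext => x; rewrite mevalE.
apply: affine_sum => m /msize_mdeg_lt mp; apply/affine_scale/affine_monomial.
by rewrite -ltnS (leq_trans mp).
Qed.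

Lemma quadratic_meval (R : realType) (p : mpoly 3 R) : (msize p <= 3)%N ->
  quadratic_fun (fun x => meval (fun l => x l 0) p).
Proof.
move=> p3; rewrite (_ : (fun x => _) = fun x : 'cV[R]_3 =>
    \sum_(m <- msupp p) mcoeff m p * \prod_i x i 0 ^+ m i); last first.
  by apply/funext => x; rewrite mevalE.
apply: quadratic_sum => m /msize_mdeg_lt mp.
apply/quadratic_scale/quadratic_monomial.
by rewrite -ltnS (leq_trans mp).
Qed.

Lemma edge_bubble_diag (R : realType) (f : 'cV[R]_3 -> R) x : edge_bubble f x x = 0.
Proof.
have mid : 2^-1 *: (x + x) = x.
  by rewrite scalerDr -scalerDl (_ : 2^-1 + 2^-1 = 1) ?scale1r//; field.
by rewrite /edge_bubble mid; ring.
Qed.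

Lemma edge_bubbleC (R : realType) (f : 'cV[R]_3 -> R) x y :
  edge_bubble f x y = edge_bubble f y x.
Proof. by rewrite /edge_bubble [y + x]addrC addrAC. Qed.

Lemma polyfun2_quadratic (R : realType) (T : set 'cV[R]_3) X
    (f : 'cV[R]_3 -> 'M[R]_3) (u y : 'cV[R]_3) : polyfun 2 T X f ->
  exists2 F, quadratic_fun F & forall x, T x -> dot u (f x *m y) = F x.
Proof.
move=> [_ [P [P2 fP]]].
exists (fun x => \sum_(k : 'I_3 * 'I_3)
    u k.1 0 * y k.2 0 * meval (fun l => x l 0) (P k.1 k.2)).
  by apply: quadratic_sum => k _; apply/quadratic_scale/quadratic_meval.
move=> x Tx; rewrite dot_mulmxE; apply: eq_bigr => k _.
by rewrite fP// mxE.
Qed.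

Lemma polyfun1_affine (R : realType) (T : set 'cV[R]_3) X
    (f : 'cV[R]_3 -> 'M[R]_3) (u y : 'cV[R]_3) : polyfun 1 T X f ->
  exists2 F, affine_fun F & forall x, T x -> dot u (f x *m y) = F x.
Proof.
move=> [_ [P [P2 fP]]].
exists (fun x => \sum_(k : 'I_3 * 'I_3)
    u k.1 0 * y k.2 0 * meval (fun l => x l 0) (P k.1 k.2)).
  by apply: affine_sum => k _; apply/affine_scale/affine_meval.
move=> x Tx; rewrite dot_mulmxE; apply: eq_bigr => k _.
by rewrite fP// mxE.
Qed.

(** Supplies the test functions for the face degrees of freedom: barycentric
    coordinates times a constant vector. *)
Lemma affine_polyfun1 (R : realType) (T : set 'cV[R]_3) (u : 'cV[R]_3) (k : R)
    (y : 'cV[R]_3) :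
  polyfun 1 T setT (fun x => (dot u x + k) *: y).
Proof.
split=> //; exists (fun i _ => mpolyC 3 (y i 0 * k) +
  \sum_l (y i 0 * u l 0) *: mpolyX R (mnm1 l)); split=> [i j|x _].
  apply: leq_trans (msizeD_le _ _) _; rewrite geq_max; apply/andP; split.
    by rewrite msizeC; case: (_ == _).
  apply: leq_trans (msize_sum _ _ _) _; apply/bigmax_leqP => l _.
  by apply: leq_trans (msizeZ_le _ _) _; rewrite msizeX mdeg1.
apply/matrixP => i j; rewrite !mxE ord1 mevalD mevalC raddf_sum /= dotE.
rewrite mulrDl mulr_suml addrC; congr (_ + _); first by rewrite mulrC.
by apply: eq_bigr => l _; rewrite mevalZ mevalXU; ring.
Qed.

(** * Moments of quadratic functions on a triangle *)

Lemma integral_exprn (R : realType) (n : nat) (t : R) : 0 <= t ->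
  (\int[lebesgue_measure]_(y in `[0%R, t]) (y ^+ n)%:E =
   (t ^+ n.+1 / n.+1%:R)%:E)%E.
Proof.
rewrite le_eqVlt => /predU1P[<-|t0].
  by rewrite set_itv1 integral_set1 expr0n mul0r.
have dX : forall x : R, derivable (fun y : R => y ^+ n.+1 / n.+1%:R) x 1.
  by move=> x; apply: derivableM => //; exact: exprn_derivable.
have cX : continuous (fun y : R => y ^+ n.+1 / n.+1%:R).
  by move=> x; apply: cvgM; [exact: exprn_continuous|exact: cvg_cst].
rewrite (@continuous_FTC2 _ _ (fun y => y ^+ n.+1 / n.+1%:R))//.
- by rewrite expr0n mul0r sube0.
- by apply: continuous_in_subspaceT => x _; exact: exprn_continuous.
- split=> //.
  + by apply: cvg_at_right_filter; exact: cX.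
  + by apply: cvg_at_left_filter; exact: cX.
- move=> x _; rewrite derive1Mr; last exact: exprn_derivable.
  by rewrite derive1E exp_derive scaler1 mulrAC divff// mul1r.
Qed.

Lemma measurable_reference_triangle (R : realType) :
  measurable (@reference_triangle R :
    set (measurableTypeR R * measurableTypeR R)).
Proof.
have -> : @reference_triangle R =
    ((fst @^-1` `[0%R, +oo[) `&` (snd @^-1` `[0%R, +oo[)) `&`
    ((fun p => p.1 + p.2) @^-1` `]-oo, 1%R]).
  apply/seteqP; split=> p /=; rewrite !in_itv/= ?andbT.
    by case.
  by case=> -[].
apply: measurableI; first apply: measurableI.
- by rewrite -[X in measurable X]setTI; exact: measurable_fst.
- by rewrite -[X in measurable X]setTI; exact: measurable_snd.
- rewrite -[X in measurable X]setTI.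
  have : measurable_fun setT (fun p : R * R => p.1 + p.2).
    by apply: measurable_funD; [exact: measurable_fst|exact: measurable_snd].
  by apply.
Qed.

(** By Tonelli the inner integral is [x ^+ m * (1 - x) ^+ n.+1 / n.+1], and the
    outer one is a Beta integral. *)
Lemma integral_triangle_monomial (R : realType) (m n : nat) :
  \int[(@lebesgue_measure R \x @lebesgue_measure R)%E]_(p in
      @reference_triangle R) (p.1 ^+ m * p.2 ^+ n) =
  (m`! * n`!)%:R / (m + n).+2`!%:R.
Proof.
rewrite /Rintegral integral_mkcond fubini_tonelli1/=; last 2 first.
- apply: (iffLR (measurable_restrictT _ (@measurable_reference_triangle R))).
  apply/measurable_EFinP/measurable_funM; apply: measurable_funX.
  + exact: (measurable_funS measurableT).
  + exact: (measurable_funS measurableT).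
- move=> p; rewrite patchE; case: ifPn => // /set_mem[p0 q0 _].
  by rewrite lee_fin mulr_ge0// exprn_ge0.
transitivity (fine (\int[lebesgue_measure]_x
    (n.+1%:R^-1 * ((@XMonemX R m n.+1) \_ `[0, 1] x))%:E)%E).
  congr fine; apply: eq_integral => x _; rewrite /fubini_F patchE.
  case: ifPn => [/set_mem|]; rewrite ?notin_setE /= in_itv/=.
    move=> /andP[x0 x1].
    transitivity (\int[lebesgue_measure]_(y in `[0%R, (1 - x)%R])
        (x ^+ m * y ^+ n)%:E)%E.
      rewrite [RHS]integral_mkcond; apply: eq_integral => y _.
      rewrite !patchE.
      congr (if _ then _ else _).
      apply/idP/idP => /set_mem H; apply/mem_set; move: H => /=; rewrite in_itv/=.
        case=> /= _ y0 xy; rewrite y0/=; lra.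
      by move=> /andP[y0 y1]; split => //=; lra.
    under eq_integral do rewrite EFinM.
    rewrite ge0_integralZl//; last 3 first.
    - apply/measurable_EFinP/measurable_funX; exact: measurable_id.
    - by move=> y /=; rewrite in_itv/= => /andP[y0 _]; rewrite lee_fin exprn_ge0.
    - by rewrite lee_fin exprn_ge0.
    rewrite integral_exprn ?subr_ge0// -EFinM; congr EFin.
    by rewrite /XMonemX /unstable.onem; field; rewrite addrC natr1 pnatr_eq0.
  move=> x01; rewrite mulr0; apply: integral0_eq => y _.
  rewrite patchE ifF//; apply/negbTE; rewrite notin_setE => -[/= x0 y0 xy].
  by apply: x01; apply/andP; split => //; lra.
under eq_integral do rewrite EFinM.
rewrite ge0_integralZl//; last 2 first.
- apply/measurable_EFinP;  apply: (iffLR (measurable_restrictT _ _)) => //.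
  exact: measurable_XMonemX.
- move=> x _; rewrite lee_fin patchE; case: ifPn => // /set_mem H.
  exact: XMonemX_ge0.
have := @EFin_beta_fun R m.+1 n.+2; rewrite /= => <-.
rewrite /= beta_fun_fact factS addnS.
rewrite mulrA; congr (_ / _).
by rewrite !natrM; field.
Qed.

Lemma reference_triangle_finite (R : realType) :
  ((@lebesgue_measure R \x @lebesgue_measure R)
     (@reference_triangle R) < +oo)%E.
Proof.
apply: (@le_lt_trans _ _ ((@lebesgue_measure R \x @lebesgue_measure R)%E
   (`[0%R, 1%R] `*` `[0%R, 1%R])))%E.
  apply: le_measure; rewrite ?inE.
  - exact: (@measurable_reference_triangle R).
  - exact: measurableX.
  - by move=> p [/= x0 y0 xy]; split; rewrite /= in_itv/=; lra.
rewrite product_measure1E//= lebesgue_measure_itv/= lte_fin ltr01.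
by rewrite -EFinB -EFinM ltry.
Qed.

Lemma Rintegral_sum d (T : measurableType d) (R : realType)
    (mu : {measure set T -> \bar R}) (D : set T) (I : Type) (s : seq I)
    (h : I -> T -> R) : measurable D ->
  (forall i, mu.-integrable D (EFin \o h i)) ->
  \int[mu]_(x in D) (\sum_(i <- s) h i x) =
  \sum_(i <- s) \int[mu]_(x in D) h i x.
Proof.
move=> mD ih; elim: s => [|i s IHs].
  under eq_Rintegral do rewrite big_nil.
  by rewrite Rintegral_cst// mul0r big_nil.
under eq_Rintegral do rewrite big_cons.
rewrite RintegralD//; first by rewrite IHs big_cons.
have -> : EFin \o (fun x => \sum_(j <- s) h j x) =
    fun x => (\sum_(j <- s) (h j x)%:E)%E.
  by apply/funext => x /=; rewrite sumEFin.
by apply: integrable_sum => // j _; exact: ih.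
Qed.

(** Numbered so that [triangle_parametrization] sends coordinate [l] to
    vertex [l]. *)
Definition triangle_coord (R : realType) (l : 'I_3) (p : R * R) : R :=
  if l == 0 then 1 - p.1 - p.2 else if l == 1 then p.1 else p.2.

Lemma triangle_coord_sum (R : realType) (p : R * R) :
  \sum_l triangle_coord l p = 1.
Proof.
by rewrite 3!big_ord_recl big_ord0 /triangle_coord /=; ring.
Qed.

Lemma triangle_coord_ge0 (R : realType) (l : 'I_3) (p : R * R) :
  reference_triangle p -> 0 <= triangle_coord l p.
Proof.
move=> [p0 q0 pq]; rewrite /triangle_coord.
by case: ifP => _; [lra|case: ifP => _; lra].
Qed.

Definition triangle_monomial (R : realType) (k m n : nat) (p : R * R) : R :=
  (1 - p.1 - p.2) ^+ k * p.1 ^+ m * p.2 ^+ n.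

Lemma measurable_triangle_monomial (R : realType) (k m n : nat) :
  measurable_fun setT (@triangle_monomial R k m n).
Proof.
have m1 : measurable_fun setT (fst : R * R -> R) by exact: measurable_fst.
have m2 : measurable_fun setT (snd : R * R -> R) by exact: measurable_snd.
apply: measurable_funM; first apply: measurable_funM; apply: measurable_funX => //.
by apply: measurable_funB => //; apply: measurable_funB.
Qed.

Lemma integrable_triangle_monomial (R : realType) (k m n : nat) :
  (@lebesgue_measure R \x @lebesgue_measure R)%E.-integrable
    (@reference_triangle R) (EFin \o @triangle_monomial R k m n).
Proof.
apply: measurable_bounded_integrable.
- exact: (@measurable_reference_triangle R).
- exact: reference_triangle_finite.
- apply: (measurable_funS measurableT) => //.
  exact: measurable_triangle_monomial.
exists 1; split => // M M1 p /= [p0 q0 pq]; apply: (le_trans _ (ltW M1)).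
have norm_exp (x : R) i : 0 <= x -> x <= 1 -> `|x ^+ i| <= 1.
  by move=> x0 x1; rewrite normrX ger0_norm// exprn_ile1.
rewrite !normrM !mulr_ile1 ?mulr_ge0 ?normr_ge0 ?norm_exp//=; lra.
Qed.

(** Dirichlet's formula. Expanding one factor [1 - x - y] lowers [k] by one, and
    the right-hand side satisfies the same recursion. *)
Lemma integral_barycentric_monomial (R : realType) (k m n : nat) :
  \int[(@lebesgue_measure R \x @lebesgue_measure R)%E]_(p in
      @reference_triangle R) triangle_monomial k m n p =
  (k`! * m`! * n`!)%:R / (k + m + n).+2`!%:R.
Proof.
elim: k m n => [|k IHk] m n.
  rewrite mul1n add0n -integral_triangle_monomial.
  by apply: eq_Rintegral => p _; rewrite /triangle_monomial expr0 mul1r.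
under eq_Rintegral => p _.
  have -> : triangle_monomial k.+1 m n p = triangle_monomial k m n p
      - (triangle_monomial k m.+1 n p + triangle_monomial k m n.+1 p).
    by rewrite /triangle_monomial !exprS; ring.
  over.
have mT := @measurable_reference_triangle R.
have iT := @integrable_triangle_monomial R.
rewrite RintegralB ?RintegralD//=;
  last exact: (integrableD mT (iT k m.+1 n) (iT k m n.+1)).
rewrite !IHk !(addnS, addSn) (factS (k + m + n).+2) (factS k) (factS m) (factS n).
have : (k + m + n).+2`!%:R != 0 :> R by rewrite pnatr_eq0 -lt0n fact_gt0.
move: (_.+2)`! => F F0; rewrite !natrM; field.
by rewrite F0 -!natrD pnatr_eq0.
Qed.

Lemma integral_triangle_coord_prod (R : realType) (e : 'I_3 -> nat) :
  \int[(@lebesgue_measure R \x @lebesgue_measure R)%E]_(p in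
      @reference_triangle R) (\prod_l triangle_coord l p ^+ e l) =
  (\prod_l (e l)`!)%:R / (\sum_l e l).+2`!%:R.
Proof.
rewrite [in RHS]big_ord_recl [in RHS]big_ord_recl [in RHS]big_ord1 mulnA.
rewrite !big_ord_recl big_ord0 addn0 addnA -integral_barycentric_monomial.
apply: eq_Rintegral => p _.
by rewrite !big_ord_recl big_ord0 mulr1 mulrA.
Qed.

Lemma integrable_triangle_coord_prod (R : realType) (e : 'I_3 -> nat) :
  (@lebesgue_measure R \x @lebesgue_measure R)%E.-integrable
    (@reference_triangle R) (fun p => (\prod_l triangle_coord l p ^+ e l)%:E).
Proof.
rewrite (_ : (fun p => _) = EFin \o @triangle_monomial R (e ord0)
  (e (lift ord0 ord0)) (e (lift ord0 (lift ord0 ord0)))).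
  exact: integrable_triangle_monomial.
apply/funext => p /=.
by rewrite !big_ord_recl big_ord0 mulr1 mulrA.
Qed.

Lemma prod_expr_delta (R : comRingType) (I : finType) (w : I -> R) (i : I) :
  \prod_l w l ^+ (i == l) = w i.
Proof.
rewrite (bigD1 i)//= eqxx expr1 big1 ?mulr1// => l li.
by rewrite eq_sym (negbTE li) expr0.
Qed.

(** Builds the product of the factorials of the multiplicities one index at a
    time: each new index contributes one plus the number of its earlier
    occurrences. *)
Lemma prod_fact_delta (I : finType) (e : I -> nat) (i : I) :
  (\prod_l (e l + (i == l))`! = (e i).+1 * \prod_l (e l)`!)%N.
Proof.
rewrite (bigD1 i)//= [in RHS](bigD1 i)//= eqxx addn1 factS mulnA; congr (_ * _)%N.
by apply: eq_bigr => l li; rewrite eq_sym (negbTE li) addn0.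
Qed.

Lemma triangle_coord3E (R : realType) (i j k : 'I_3) (p : R * R) :
  triangle_coord i p * triangle_coord j p * triangle_coord k p =
  \prod_l triangle_coord l p ^+ ((i == l) + (j == l) + (k == l)).
Proof.
under eq_bigr do rewrite 2!exprD.
by rewrite 2!big_split/= !(prod_expr_delta (fun l => triangle_coord l p)).
Qed.

Lemma integral_triangle_coord3 (R : realType) (i j k : 'I_3) :
  \int[(@lebesgue_measure R \x @lebesgue_measure R)%E]_(p in
      @reference_triangle R)
    (triangle_coord i p * triangle_coord j p * triangle_coord k p) =
  ((1 + (i == j)%:R) * (1 + (i == k)%:R + (j == k)%:R)) / 120%:R.
Proof.
under eq_Rintegral do rewrite triangle_coord3E.
have sum_delta m : (\sum_(l < 3) (m == l) = 1)%N.
  by rewrite (bigD1 m)//= eqxx big1// => l /negbTE; rewrite eq_sym => ->.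
rewrite integral_triangle_coord_prod !big_split/= !sum_delta.
rewrite (prod_fact_delta (fun l => (i == l) + (j == l))%N) prod_fact_delta.
rewrite [X in (_ * (_ * X))%N]big1 => [|l _]; last by case: (i == l).
rewrite muln1 (_ : (1 + 1 + 1).+2`! = 120)%N//; congr (_ / _).
by rewrite natrM -!natr1 natrD; ring.
Qed.

Lemma integrable_triangle_coord3 (R : realType) (i j k : 'I_3) :
  (@lebesgue_measure R \x @lebesgue_measure R)%E.-integrable
    (@reference_triangle R) (fun p =>
      (triangle_coord i p * triangle_coord j p * triangle_coord k p)%:E).
Proof.
under eq_fun do rewrite triangle_coord3E.
exact: integrable_triangle_coord_prod.
Qed.

Lemma integral_quadratic_triangle_coord (R : realType) (v : 'I_3 -> R)
    (c : 'I_3 -> 'I_3 -> R) (r : 'I_3) :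
  (forall m n, c m n = c n m) -> (forall m, c m m = 0) ->
  \int[(@lebesgue_measure R \x @lebesgue_measure R)%E]_(p in
      @reference_triangle R)
    (barycentric_quadratic v c (fun m => triangle_coord m p) * triangle_coord r p) =
  (5%:R * (\sum_m v m + v r) + \sum_m c r m
     + 2^-1 * \sum_m \sum_n c m n) / 120%:R.
Proof.
move=> cC c0.
have mT := @measurable_reference_triangle R.
have iT := @integrable_triangle_coord3 R.
pose u (q : 'I_3 * 'I_3) := v q.1 + 2^-1 * c q.1 q.2.
pose g (q : 'I_3 * 'I_3) (p : R * R) :=
  triangle_coord q.1 p * triangle_coord q.2 p * triangle_coord r p.
transitivity (\int[(@lebesgue_measure R \x @lebesgue_measure R)%E]_(p in
    @reference_triangle R) \sum_q u q * g q p).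
  apply: eq_Rintegral => p _; rewrite quadratic_homogenize ?triangle_coord_sum//.
  rewrite pair_bigA mulr_suml; apply: eq_bigr => q _.
  by rewrite -mulrA.
rewrite Rintegral_sum//; last first.
  move=> q; rewrite (_ : EFin \o _ = fun p => ((u q)%:E * (g q p)%:E)%E)//.
  by apply: integrableZl => //; exact: iT.
have gE q : \int[(@lebesgue_measure R \x @lebesgue_measure R)%E]_(p in
      @reference_triangle R) (u q * g q p) = u q *
    (((1 + (q.1 == q.2)%:R) * (1 + (q.1 == r)%:R + (q.2 == r)%:R)) / 120%:R).
  by rewrite -integral_triangle_coord3 RintegralZl//; exact: iT.
under eq_bigr do rewrite gE.
rewrite -(pair_bigA _ (fun m n => (v m + 2^-1 * c m n) *
  ((1 + (m == n)%:R) * (1 + (m == r)%:R + (n == r)%:R) / 120%:R)))/=.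
pose i0 : 'I_3 := ord0; pose i1 : 'I_3 := lift ord0 ord0.
pose i2 : 'I_3 := lift ord0 (lift ord0 ord0).
have r_cases : [\/ r = i0, r = i1 | r = i2].
  by case: (r) => [[|[|[|]]]]//= ?;
    [constructor 1|constructor 2|constructor 3]; apply/val_inj.
rewrite !big_ord_recl !big_ord0 !c0 (cC i1 i0) (cC i2 i0) (cC i2 i1).
by case: r_cases => ->; rewrite !c0 ?(cC i1 i0) ?(cC i2 i0) ?(cC i2 i1) /=; field.
Qed.

Lemma triangle_parametrization (R : realType) (b : 'I_3 -> 'cV[R]_3) (p : R * R) :
  b ord0 + spread b *m \col_l (if l == ord0 :> 'I_2 then p.1 else p.2) =
  \sum_l triangle_coord l p *: b l.
Proof.
apply/colP => k; rewrite summxE !mxE !big_ord_recl !big_ord0 !mxE.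
by rewrite /triangle_coord /=; ring.
Qed.

(** * The frame of barycentric gradients *)

Lemma hull_vertex (R : realType) k (b : 'I_k -> 'cV[R]_3) i : hull b (b i).
Proof.
exists (fun j => (j == i)%:R); split.
- by move=> j; rewrite ler0n.
- by rewrite (bigD1 i)//= eqxx big1 ?addr0// => j /negbTE ->.
- rewrite (bigD1 i)//= eqxx scale1r big1 ?addr0// => j /negbTE ->.
  by rewrite scale0r.
Qed.

(** The gradients enter only through their duality with the edge vectors, which
    says that [g i] pairs with a displacement to the change of a function that
    is 1 at vertex [i] and 0 at the others. *)
Section TetrahedronFrame.
Variables (R : realType) (a : 'I_4 -> 'cV[R]_3) (g : 'I_4 -> 'cV[R]_3).
Hypothesis g_dual : forall i k l,
  dot (g i) (a k - a l) = (i == k)%:R - (i == l)%:R.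

(** The affine function with gradient [g i] and value 1 at vertex [i]. *)
Definition barycentric_coord (i : 'I_4) (x : 'cV[R]_3) : R :=
  dot (g i) (x - a i) + 1.
Local Notation lam := barycentric_coord.

Lemma barycentric_coord_vertex i m : lam i (a m) = (i == m)%:R.
Proof. by rewrite /lam g_dual eqxx subrK. Qed.

Lemma barycentric_coordB i x y : lam i x - lam i y = dot (g i) (x - y).
Proof. by rewrite /lam !dotBr; ring. Qed.

Lemma barycentric_coord_affine i : affine_fun (lam i).
Proof.
have gE : affine_fun (dot (g i)).
  move=> I b w w1; rewrite dotE.
  transitivity (\sum_k \sum_m g i k 0 * b m k 0 * w m).
    apply: eq_bigr => k _; rewrite summxE mulr_sumr; apply: eq_bigr => m _.
    by rewrite mxE; ring.
  rewrite exchange_big; apply: eq_bigr => m _.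
  by rewrite dotE mulr_suml.
rewrite (_ : lam i = fun x => dot (g i) x + (1 - dot (g i) (a i))).
  by apply: affine_add => //; exact: affine_cst.
by apply/funext => x; rewrite /lam dotBr; ring.
Qed.

Lemma barycentric_coord_comb i (w : 'I_4 -> R) : \sum_m w m = 1 ->
  lam i (\sum_m w m *: a m) = w i.
Proof.
move=> w1; rewrite barycentric_coord_affine// (bigD1 i)//=.
rewrite barycentric_coord_vertex eqxx mul1r big1 ?addr0// => m mi.
by rewrite barycentric_coord_vertex eq_sym (negbTE mi) mul0r.
Qed.

(** The duality relation for the edges issued from vertex 0, in matrix form. *)
Lemma frame_spread :
  (\matrix_(l < 3) (g (lift ord0 l))^T) *m spread a = 1%:M.
Proof.
apply/matrixP => l m; rewrite !mxE.
transitivity (dot (g (lift ord0 l)) (a (lift ord0 m) - a ord0)).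
  by rewrite dotE; apply: eq_bigr => k _; rewrite !mxE.
by rewrite g_dual (inj_eq lift_inj) subr0.
Qed.

Lemma frame_unitmx : (\matrix_(l < 3) (g (lift ord0 l))^T) \in unitmx.
Proof. by have [] := mulmx1_unit frame_spread. Qed.

Lemma frame_nondegenerate (y : 'cV[R]_3) : (forall i, dot (g i) y = 0) -> y = 0.
Proof.
move=> gy; apply: (can_inj (mulKmx frame_unitmx)); rewrite mulmx0.
apply/colP => l; rewrite [RHS]mxE -[RHS](gy (lift ord0 l)) dotE mxE.
by apply: eq_bigr => k _; rewrite !mxE.
Qed.

(** Each edge vector [a m - a 0] pairs to 1 with [g m], to -1 with [g 0] and to
    0 with the others; and these edge vectors form a basis. *)
Lemma frame_sum : \sum_i g i = 0.
Proof.
have s_unit : spread a \in unitmx by have [] := mulmx1_unit frame_spread.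
apply: (can_inj (@trmxK _ _ _)); rewrite trmx0.
apply: (can_inj (mulmxK s_unit)); rewrite mul0mx.
apply/rowP => m; rewrite !mxE.
transitivity (\sum_i dot (g i) (a (lift ord0 m) - a ord0)).
  under [RHS]eq_bigr do rewrite dotE.
  rewrite [RHS]exchange_big /=; apply: eq_bigr => k _.
  by rewrite !mxE summxE mulr_suml.
under eq_bigr do rewrite g_dual.
rewrite sumrB (bigD1 (lift ord0 m))//= (bigD1 ord0 (P := xpredT))//= !eqxx.
by rewrite !big1 ?addr0 ?subrr// => i /negbTE ->.
Qed.

Lemma barycentric_coord_sum x : \sum_i lam i x = 1.
Proof.
rewrite -(subrK 1 (\sum_i lam i x)).
have <- : \sum_i lam i (a ord0) = 1.
  rewrite (bigD1 ord0)//= barycentric_coord_vertex eqxx big1 ?addr0// => i /negbTE.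
  by rewrite barycentric_coord_vertex => ->.
rewrite -sumrB; under eq_bigr do rewrite barycentric_coordB.
rewrite [X in X + _](_ : _ = dot (\sum_i g i) (x - a ord0)).
  by rewrite frame_sum /dot trmx0 mul0mx mxE add0r.
rewrite dotC dotE; under [RHS]eq_bigr do rewrite summxE mulr_sumr.
rewrite [RHS]exchange_big /=; apply: eq_bigr => i _; rewrite dotC dotE.
by [].
Qed.

Lemma barycentric_coordK x : \sum_i lam i x *: a i = x.
Proof.
apply/subr0_eq/frame_nondegenerate => i; rewrite -barycentric_coordB.
by rewrite barycentric_coord_comb ?barycentric_coord_sum// subrr.
Qed.

Lemma hullP x : hull a x <-> forall i, 0 <= lam i x.
Proof.
split=> [[w [w0 w1 ->]] i|x0]; first by rewrite barycentric_coord_comb.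
exists (lam ^~ x); split => //; first exact: barycentric_coord_sum.
by rewrite barycentric_coordK.
Qed.

Lemma hull_convex (I : finType) (b : I -> 'cV[R]_3) (w : I -> R) :
  (forall m, hull a (b m)) -> (forall m, 0 <= w m) -> \sum_m w m = 1 ->
  hull a (\sum_m w m *: b m).
Proof.
move=> bh w0 w1; apply/hullP => i; rewrite barycentric_coord_affine//.
by apply: sumr_ge0 => m _; rewrite mulr_ge0//; have /hullP := bh m.
Qed.

Lemma hull_midpoint x y : hull a x -> hull a y -> hull a (2^-1 *: (x + y)).
Proof.
move=> hx hy; have := @hull_convex bool (fun b => if b then x else y) (fun=> 2^-1).
rewrite !big_bool/= scalerDr; apply; first by case.
- by move=> _; lra.
- by lra.
Qed.

(** As the gradients add up to zero, the diagonal entries of [A] in this frame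
    are minus the sums of the off-diagonal ones. *)
Lemma frame_bilinear_eq0 (A : 'M[R]_3) :
  (forall i j, i != j -> dot (g i) (A *m g j) = 0) -> A = 0.
Proof.
move=> gA.
have gA' i j : dot (g i) (A *m g j) = 0.
  have [<-|ij] := eqVneq i j; last exact: gA.
  have giE : g i = - \sum_(k | k != i) g k.
    by have /eqP := frame_sum; rewrite (bigD1 i)//= addr_eq0 => /eqP.
  rewrite {2}giE mulmxN mulmx_sumr /dot mulmxN mulmx_sumr !mxE summxE.
  by rewrite big1 ?oppr0// => k ki; apply: gA; rewrite eq_sym.
have Ag j : A *m g j = 0 by apply: frame_nondegenerate => i.
apply/trmx_inj/(can_inj (mulKmx frame_unitmx)).
rewrite trmx0 mulmx0; apply: trmx_inj; rewrite trmx_mul trmxK trmx0.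
apply/matrixP => k l; rewrite [RHS]mxE.
have /colP/(_ k) := Ag (lift ord0 l); rewrite [RHS]mxE => AgE.
rewrite -[RHS]AgE !mxE; by apply: eq_bigr => m _; rewrite !mxE.
Qed.
End TetrahedronFrame.

(** * Integrals over the tetrahedron *)

Section TetrahedronVolume.
Variables (R : realType) (a : 'I_4 -> 'cV[R]_3) (g : 'I_4 -> 'cV[R]_3).
Hypothesis g_dual : forall i k l,
  dot (g i) (a k - a l) = (i == k)%:R - (i == l)%:R.
Local Notation lam := (barycentric_coord a g).
Local Notation mu1 := (@lebesgue_measure R).
Local Notation mu := ((mu1 \x mu1) \x mu1)%E.
Local Notation space :=
  (measurableTypeR R * measurableTypeR R * measurableTypeR R)%type.
Local Notation K := (@point3 R @^-1` hull a).

Lemma measurable_barycentric_coord i :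
  measurable_fun setT (fun p : space => lam i (point3 p)).
Proof.
have mp k : measurable_fun setT (fun p : space => point3 p k 0).
  have m1 : measurable_fun setT (fst : space -> _) by exact: measurable_fst.
  rewrite (_ : (fun p => _) = fun p : space =>
    if k == 0 then p.1.1 else if k == 1 then p.1.2 else p.2); last first.
    by apply/funext => p; rewrite mxE.
  case: (k == 0); first by apply: measurableT_comp m1; exact: measurable_fst.
  case: (k == 1); first by apply: measurableT_comp m1; exact: measurable_snd.
  exact: measurable_snd.
rewrite (_ : (fun p => _) = fun p : space =>
    (\sum_k g i k 0 * (point3 p k 0 - a i k 0)) + 1); last first.
  apply/funext => p; rewrite /barycentric_coord dotE; congr (_ + _).
  by apply: eq_bigr => k _; rewrite !mxE.
apply: measurable_funD => //; apply: measurable_sum => k.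
by apply: measurable_funM => //; apply: measurable_funB.
Qed.

Lemma measurable_hull : measurable (K : set space).
Proof.
have -> : K = \bigcap_(i in [set: 'I_4])
    ((fun p : space => lam i (point3 p)) @^-1` `[0, +oo[).
  apply/seteqP; split=> p.
    by move=> /(hullP g_dual) p0 i _; rewrite /= in_itv/= p0.
  move=> p0; apply/(hullP g_dual) => i; have := p0 i I.
  by rewrite /= in_itv/= andbT.
apply: fin_bigcap_measurable => //.
move=> i _; rewrite -[X in measurable X]setTI.
exact: measurable_barycentric_coord.
Qed.

Lemma lebesgue_box (x y z r : R) : 0 <= r ->
  mu (`[x - r, x + r] `*` `[y - r, y + r] `*` `[z - r, z + r]) =
    ((2%:R * r) ^+ 3)%:E.
Proof.
move=> r0.
have itvE t : mu1 `[t - r, t + r] = (2%:R * r)%:E.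
  rewrite lebesgue_measure_itv/= lte_fin; case: ltP => tr.
    by rewrite -EFinB; congr EFin; ring.
  by congr EFin; lra.
rewrite product_measure1E//; last exact: measurableX.
transitivity (mu1 `[(x - r)%R, (x + r)%R]%classic *
    mu1 `[(y - r)%R, (y + r)%R]%classic * mu1 `[(z - r)%R, (z + r)%R]%classic)%E.
  by congr (_ * _)%E; exact: product_measure1E.
by rewrite !itvE -!EFinM; congr EFin; ring.
Qed.

Lemma volume_hull_finite : (mu K < +oo)%E.
Proof.
pose B := \sum_i \sum_k `|a i k 0|.
have B0 : 0 <= B by do 2 apply: sumr_ge0 => ? _.
pose box : set space := `[0 - B, 0 + B] `*` `[0 - B, 0 + B] `*` `[0 - B, 0 + B].
apply: (@le_lt_trans _ _ (mu box)); last by rewrite lebesgue_box// ltry.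
apply: le_measure; rewrite ?inE.
- exact: measurable_hull.
- by apply: measurableX => //; exact: measurableX.
move=> p /(hullP g_dual) p0.
have pB k : `|point3 p k 0| <= B.
  rewrite -(barycentric_coordK g_dual (point3 p)) summxE.
  apply: (le_trans (ler_norm_sum _ _ _)); apply: ler_sum => i _.
  rewrite mxE normrM (le_trans (ler_piMl _ _))//.
    rewrite ger0_norm// -(barycentric_coord_sum g_dual (point3 p)).
    by rewrite (bigD1 i)//= lerDl sumr_ge0.
  by rewrite (bigD1 k)//= lerDl sumr_ge0.
have := pB 0; have := pB 1; have := pB 2; rewrite !mxE/= !ler_norml => ? ? ?.
by split; [split|]; rewrite /= in_itv/= sub0r add0r.
Qed.

Lemma barycentric_coord_le1 i x : hull a x -> lam i x <= 1.
Proof.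
move=> /(hullP g_dual) x0; rewrite -(barycentric_coord_sum g_dual x).
by rewrite (bigD1 i)//= lerDl sumr_ge0.
Qed.

Lemma integrable_barycentric_coord2 i j :
  mu.-integrable K (fun p => (lam i (point3 p) * lam j (point3 p))%:E).
Proof.
apply: (measurable_bounded_integrable measurable_hull volume_hull_finite).
  apply: measurable_funTS; apply: measurable_funM;
    exact: measurable_barycentric_coord.
exists 1; split => // M M1 p /= hp; apply: (le_trans _ (ltW M1)).
have /(hullP g_dual) p0 := hp.
rewrite normrM !ger0_norm// mulr_ile1 ?barycentric_coord_le1//.
Qed.

Lemma integrable_barycentric_quadratic v c :
  mu.-integrable K
    (fun p => (barycentric_quadratic v c (lam ^~ (point3 p)))%:E).
Proof.
rewrite (_ : (fun p => _) = fun p : space => (\sum_(q : 'I_4 * 'I_4)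
    (v q.1 + 2^-1 * c q.1 q.2)%:E *
     (lam q.1 (point3 p) * lam q.2 (point3 p))%:E)%E).
  apply: integrable_sum => //; first exact: measurable_hull.
  move=> q _; apply: integrableZl => //; first exact: measurable_hull.
  exact: integrable_barycentric_coord2.
apply/funext => p; rewrite quadratic_homogenize ?barycentric_coord_sum//.
by rewrite pair_bigA -sumEFin.
Qed.

(** On a small cube around the centroid both coordinates, equal to 1/4 at the
    centre, stay above 1/8. *)
Lemma integral_barycentric_coord2_neq0 i j :
  \int[mu]_(p in K) (lam i (point3 p) * lam j (point3 p)) != 0.
Proof.
pose o := \sum_m 4^-1 *: a m.
have lam_o k : lam k o = 4^-1.
  apply: (barycentric_coord_comb g_dual k (w := fun=> 4^-1)).
  by rewrite sumr_const card_ord -[X in X = _]mulr_natl; field.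
pose S := \sum_i \sum_k `|g i k 0|.
have S0 : 0 <= S by do 2 apply: sumr_ge0 => ? _.
(* [S] bounds the variation of every coordinate in the sup norm; the added 1
   keeps the denominator positive. *)
pose r := (8%:R * (1 + S))^-1.
have r0 : 0 < r by rewrite invr_gt0; lra.
have rS : r * S <= 8%:R^-1.
  rewrite /r invfM -mulrA ler_piMr ?invr_ge0// ler_pdivrMl ?mulr1; lra.
pose box : set space := `[o 0 0 - r, o 0 0 + r] `*` `[o 1 0 - r, o 1 0 + r]
  `*` `[o 2 0 - r, o 2 0 + r].
have mbox : measurable box by apply: measurableX => //; exact: measurableX.
have lam_box k p : box p -> 8%:R^-1 <= lam k (point3 p).
  move=> pb; have po l : `|(point3 p - o) l 0| <= r.
    case: pb => -[/= ]; rewrite !in_itv/= => x0 x1 x2.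
    rewrite !mxE ler_distl; case: l => [[|[|[|]]]]//= hl.
    - by rewrite (_ : Ordinal hl = 0)//; exact/val_inj.
    - by rewrite (_ : Ordinal hl = 1)//; exact/val_inj.
    - by rewrite (_ : Ordinal hl = 2)//; exact/val_inj.
  have : `|lam k (point3 p) - lam k o| <= r * S.
    rewrite barycentric_coordB dotE (le_trans (ler_norm_sum _ _ _))//.
    apply: (@le_trans _ _ (r * \sum_l `|g k l 0|)).
      rewrite mulr_sumr; apply: ler_sum => l _.
      by rewrite normrM mulrC ler_wpM2r.
    rewrite ler_wpM2l ?(ltW r0)// /S (bigD1 k)//= lerDl.
    by do 2 apply: sumr_ge0 => ? _.
  rewrite lam_o ler_distl => /andP[+ _]; apply: le_trans.
  by rewrite lerBrDr -lerBrDl (le_trans rS)//; lra.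
have boxK : box `<=` K.
  move=> p pb; apply/(hullP g_dual) => k; apply: le_trans (lam_box k p pb).
  by rewrite invr_ge0.
have mf D : measurable_fun (D : set space)
    (fun p => (lam i (point3 p) * lam j (point3 p))%:E).
  apply/measurable_funTS/measurable_EFinP; apply: measurable_funM;
    exact: measurable_barycentric_coord.
have : (((8%:R^-1) ^+ 2)%:E * mu box <=
    \int[mu]_(p in K) (lam i (point3 p) * lam j (point3 p))%:E)%E.
  rewrite -integral_cst//.
  apply: (@le_trans _ _
     (\int[mu]_(p in box) (lam i (point3 p) * lam j (point3 p))%:E)%E).
    apply: ge0_le_integral => //.
    - by move=> p _; rewrite lee_fin exprn_ge0// invr_ge0.
    - by move=> p pb; rewrite lee_fin expr2 ler_pM ?lam_box ?invr_ge0.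
  apply: ge0_subset_integral => //; first exact: measurable_hull.
  by move=> p /(hullP g_dual) p0; rewrite lee_fin mulr_ge0.
rewrite lebesgue_box ?(ltW r0)// -EFinM.
have fin := integrable_fin_num measurable_hull (integrable_barycentric_coord2 i j).
rewrite -(fineK fin) lee_fin => h; rewrite gt_eqF//; apply: lt_le_trans h.
by rewrite mulr_gt0// exprn_gt0// ?invr_gt0// mulr_gt0.
Qed.
End TetrahedronVolume.

(** * Frame entries of a stress field *)

(** The gradients orthogonal to an edge are fixed by the projection of that
    edge; this is how the edge condition reaches the frame entries. *)
Lemma Qproj_id (R : realType) (t u : 'cV[R]_3) : dot t u = 0 -> Qproj t *m u = u.
Proof.
move=> tu; rewrite /Qproj mulmxBl mul1mx -mulmxA.
rewrite (_ : t^T *m u = 0) ?mulmx0 ?subr0//.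
by rewrite [LHS]mx11_scalar -/(dot t u) tu raddf0.
Qed.

Lemma Qproj_tr (R : realType) (t : 'cV[R]_3) : (Qproj t)^T = Qproj t.
Proof. by rewrite /Qproj linearB/= trmx1 trmx_mul trmxK. Qed.

Lemma edge_comb (R : realType) (a : 'I_4 -> 'cV[R]_3) i j (s : R) :
  0 <= s -> s <= 1 -> edge a i j (s *: a i + (1 - s) *: a j).
Proof.
move=> s0 s1; exists (fun l => if l == ord0 then s else 1 - s); split.
- by move=> l; case: ifP => _; lra.
- by rewrite !big_ord_recl big_ord0/=; ring.
- by rewrite !big_ord_recl big_ord0/= addr0.
Qed.

Section TetrahedronStress.
Variables (R : realType) (a : 'I_4 -> 'cV[R]_3) (g : 'I_4 -> 'cV[R]_3).
Hypothesis g_dual : forall i k l,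
  dot (g i) (a k - a l) = (i == k)%:R - (i == l)%:R.
Variable sigma : 'cV[R]_3 -> 'M[R]_3.
Hypothesis sigma_in : Sigma a sigma.

Definition frame_entry (i j : 'I_4) (x : 'cV[R]_3) : R :=
  dot (g i) (sigma x *m g j).
Local Notation q := frame_entry.

Definition frame_bubble (i j m n : 'I_4) : R :=
  edge_bubble (q i j) (a m) (a n).
Local Notation c := frame_bubble.

Lemma sigma_sym x : hull a x -> (sigma x)^T = sigma x.
Proof. by have [[+ _] _] := sigma_in; exact. Qed.

Lemma frame_entryC i j x : hull a x -> q i j x = q j i x.
Proof. by move=> hx; rewrite /q dot_mulmx sigma_sym// dotC. Qed.

(** The polynomial that represents the stress agrees with it on the tetrahedron
    only, hence the convex rather than affine combinations. *)
Lemma stress_quadratic (u y : 'cV[R]_3) (I : finType) (b : I -> 'cV[R]_3) w :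
  (forall m, hull a (b m)) -> (forall m, 0 <= w m) -> \sum_m w m = 1 ->
  dot u (sigma (\sum_m w m *: b m) *m y) =
  barycentric_quadratic (fun m => dot u (sigma (b m) *m y))
    (fun m n => edge_bubble (fun x => dot u (sigma x *m y)) (b m) (b n)) w.
Proof.
move=> bh w0 w1; have [sigma2 _] := sigma_in.
have [F QF FE] := polyfun2_quadratic u y sigma2.
rewrite FE; last exact: hull_convex.
rewrite QF//; congr barycentric_quadratic.
  by apply/funext => m; rewrite FE.
apply/funext => m; apply/funext => n; rewrite /edge_bubble !FE//.
exact: (hull_midpoint g_dual).
Qed.

Lemma stress_barycentric (u y x : 'cV[R]_3) : hull a x ->
  dot u (sigma x *m y) =
  barycentric_quadratic (fun m => dot u (sigma (a m) *m y))
    (fun m l => edge_bubble (fun x => dot u (sigma x *m y)) (a m) (a l))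
    (barycentric_coord a g ^~ x).
Proof.
move=> /(hullP g_dual) x0; rewrite -{1}(barycentric_coordK g_dual x).
rewrite stress_quadratic// ?(barycentric_coord_sum g_dual)// => m.
exact: hull_vertex.
Qed.

Local Notation mu := ((@lebesgue_measure R \x @lebesgue_measure R)
  \x @lebesgue_measure R)%E.

Lemma integrable_stress_entry k l :
  mu.-integrable (@point3 R @^-1` hull a) (fun p => (sigma (point3 p) k l)%:E).
Proof.
have entryE (A : 'M[R]_3) : A k l = dot (delta_mx k 0) (A *m delta_mx l 0).
  by rewrite /dot -colE trmx_delta -rowE !mxE.
pose v m := dot (delta_mx k 0) (sigma (a m) *m delta_mx l 0).
pose c m m' := edge_bubble
  (fun x => dot (delta_mx k 0) (sigma x *m delta_mx l 0)) (a m) (a m').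
apply: (eq_integrable (measurable_hull g_dual) _ _ _
  (integrable_barycentric_quadratic g_dual v c)) => p /set_mem hp.
by rewrite entryE stress_barycentric.
Qed.

Lemma integral_frame_entry (i j : 'I_4) :
  volume_integral (hull a) sigma = 0 ->
  \int[mu]_(p in @point3 R @^-1` hull a) frame_entry i j (point3 p) = 0.
Proof.
move=> vol0; have mK := measurable_hull g_dual.
transitivity (\sum_(k : 'I_3 * 'I_3) g i k.1 0 * g j k.2 0 *
    volume_integral (hull a) sigma k.1 k.2); last first.
  by rewrite vol0 big1// => k _; rewrite mxE mulr0.
under eq_Rintegral do rewrite /frame_entry dot_mulmxE.
rewrite Rintegral_sum//.
  apply: eq_bigr => k _; rewrite RintegralZl//; first by rewrite mxE.
  exact: integrable_stress_entry.
move=> k; rewrite (_ : EFin \o _ = fun p => (((g i k.1 0 * g j k.2 0)%:E *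
    (sigma (point3 p) k.1 k.2)%:E)%E))//.
by apply: integrableZl => //; exact: integrable_stress_entry.
Qed.

Lemma frame_bubbleC i j m n : c i j m n = c j i m n.
Proof.
have hv k : hull a (a k) := hull_vertex a k.
rewrite /c /edge_bubble !(frame_entryC i j)//.
exact: (hull_midpoint g_dual).
Qed.

Lemma frame_bubble_sum i m n : \sum_j c i j m n = 0.
Proof.
have q0 x : \sum_j q i j x = 0.
  rewrite /q; under eq_bigr do rewrite dot_mulmx dotE.
  rewrite exchange_big big1//= => k _.
  by rewrite -mulr_sumr -summxE (frame_sum g_dual) [X in _ * X]mxE mulr0.
rewrite /c /edge_bubble !sumrB -!mulr_sumr !q0.
by rewrite !mulr0 !subr0.
Qed.

(** Both gradients are orthogonal to the edge, so the entry of the stress and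
    that of its projection agree along the edge, where the latter is affine. *)
Lemma frame_bubble_edge i j m n :
  i \notin [:: m; n] -> j \notin [:: m; n] -> c i j m n = 0.
Proof.
rewrite !inE !negb_or => /andP[im iN] /andP[jm jn].
have [<-|mn] := eqVneq m n; first exact: edge_bubble_diag.
pose t := edge_tangent a m n.
have tg k : k != m -> k != n -> dot t (g k) = 0.
  move=> km kn; rewrite dotC dotZr g_dual (negbTE km) (negbTE kn).
  by rewrite subrr mulr0.
have [_ /(_ m n mn) sigma1] := sigma_in.
have [F AF FE] := polyfun1_affine (g i) (g j) sigma1.
have qF x : edge a m n x -> q i j x = F x.
  move=> ex; rewrite -FE// -mulmxA Qproj_id ?tg// -mulmxA dot_mulmx Qproj_tr.
  by rewrite Qproj_id ?tg.
rewrite /c /edge_bubble !qF.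
- exact: (edge_bubble_affine (f := F)).
- have := edge_comb a m n (lexx 0) ler01.
  by rewrite scale0r add0r subr0 scale1r.
- have := edge_comb a m n ler01 (lexx 1).
  by rewrite subrr scale0r addr0 scale1r.
- have := @edge_comb _ a m n 2^-1; rewrite scalerDr => h.
  have e : 1 - 2^-1 = 2^-1 :> R by field.
  by rewrite -{2}e; apply: h; lra.
Qed.
End TetrahedronStress.

(** * Vanishing of the coefficients *)

Lemma sum_ord4 (V : nmodType) (F : 'I_4 -> V) (i j k l : 'I_4) :
  uniq [:: i; j; k; l] -> \sum_m F m = F i + F j + F k + F l.
Proof.
move=> Uijkl; transitivity (\sum_(m <- [:: i; j; k; l]) F m); last first.
  by rewrite !big_cons big_nil addr0 !addrA.
rewrite -big_enum; apply: perm_big; apply: uniq_perm => //=.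
  exact: enum_uniq.
have [||_ ijklE] := @uniq_min_size _ [:: i; j; k; l] (enum 'I_4) Uijkl.
- by move=> m _; rewrite mem_enum.
- by rewrite size_enum_ord.
- by move=> m; rewrite ijklE.
Qed.

Lemma sum_ord4_neq (V : zmodType) (F : 'I_4 -> V) (i j k l : 'I_4) :
  uniq [:: i; j; k; l] -> \sum_(m | m != i) F m = F j + F k + F l.
Proof.
move=> Uijkl; apply: (addrI (F i)).
by rewrite !addrA -(sum_ord4 _ Uijkl) [RHS](bigD1 i).
Qed.

Lemma ord4_complete (i j : 'I_4) :
  i != j -> exists k l, uniq [:: i; j; k; l].
Proof.
move=> ij; have /cards2P[k [l [kl ijE]]] : #|~: [set i; j]%SET| == 2%N.
  by rewrite cardsCs finset.setCK card_ord cards2 ij.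
exists k, l; have kl_notin m : m \in [set k; l]%SET -> (i != m) && (j != m).
  by rewrite -ijE !inE negb_or !(eq_sym m).
have /andP[ik jk] := kl_notin k (set21 k l).
have /andP[il jl] := kl_notin l (set22 k l).
by rewrite /= !inE !negb_or ij ik il jk jl kl.
Qed.

Lemma uniq4_swap12 (T : eqType) (i j k l : T) :
  uniq [:: i; j; k; l] -> uniq [:: j; i; k; l].
Proof. by rewrite (@perm_uniq _ _ [:: j; i; k; l])//; apply/permP => p /=; lia. Qed.

Lemma uniq4_swap23 (T : eqType) (i j k l : T) :
  uniq [:: i; j; k; l] -> uniq [:: i; k; j; l].
Proof. by rewrite (@perm_uniq _ _ [:: i; k; j; l])//; apply/permP => p /=; lia. Qed.

Lemma uniq4_swap34 (T : eqType) (i j k l : T) :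
  uniq [:: i; j; k; l] -> uniq [:: i; j; l; k].
Proof. by rewrite (@perm_uniq _ _ [:: i; j; l; k])//; apply/permP => p /=; lia. Qed.

(** Orthogonality to affine functions on a triangle determines the vertex values
    from the bubble coefficients, here when the one of the edge [kl] vanishes. *)
Lemma moments_determine_values (R : comRingType) (vj vk vl cjk cjl : R) :
  5%:R * (2%:R * vj + vk + vl) + 2%:R * cjk + 2%:R * cjl = 0 ->
  5%:R * (2%:R * vk + vj + vl) + 2%:R * cjk + cjl = 0 ->
  5%:R * (2%:R * vl + vj + vk) + 2%:R * cjl + cjk = 0 ->
  20%:R * vk = cjl - 3%:R * cjk /\ 20%:R * vl = cjk - 3%:R * cjl.
Proof.
move=> ej ek el; split; apply/eqP; rewrite -subr_eq0; apply/eqP.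
- transitivity (3%:R * (5%:R * (2%:R * vk + vj + vl) + 2%:R * cjk + cjl)
    - (5%:R * (2%:R * vj + vk + vl) + 2%:R * cjk + 2%:R * cjl)
    - (5%:R * (2%:R * vl + vj + vk) + 2%:R * cjl + cjk)); first by ring.
  by rewrite ej ek el mulr0 !subr0.
- transitivity (3%:R * (5%:R * (2%:R * vl + vj + vk) + 2%:R * cjl + cjk)
    - (5%:R * (2%:R * vj + vk + vl) + 2%:R * cjk + 2%:R * cjl)
    - (5%:R * (2%:R * vk + vj + vl) + 2%:R * cjk + cjl)); first by ring.
  by rewrite ej ek el mulr0 !subr0.
Qed.

(** Here [v i j m] and [c i j m n] stand for the vertex values and the bubble
    coefficients of the frame entry of index [(i, j)]. *)
Section IndexAlgebra.
Variable R : realFieldType.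
Variables (v : 'I_4 -> 'I_4 -> 'I_4 -> R) (c : 'I_4 -> 'I_4 -> 'I_4 -> 'I_4 -> R).
Hypothesis vC : forall i j m, v i j m = v j i m.
Hypothesis cC : forall i j m n, c i j m n = c j i m n.
Hypothesis ct : forall i j m n, c i j m n = c i j n m.
Hypothesis c0 : forall i j m, c i j m m = 0.
Hypothesis c_sum : forall i m n, \sum_j c i j m n = 0.
Hypothesis c_edge : forall i j m n, i \notin [:: m; n] -> j \notin [:: m; n] ->
  c i j m n = 0.
Hypothesis face_moment : forall i j r, r != i ->
  5%:R * (\sum_(m | m != i) v i j m + v i j r) + \sum_(m | m != i) c i j r m
  + 2^-1 * (\sum_(m | m != i) \sum_(n | n != i) c i j m n) = 0.

(** The equation for the test function of vertex [j] of face [i], written out on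
    the three vertices of that face. *)
Lemma face_moment_distinct i j k l m : uniq [:: i; j; k; l] ->
  5%:R * (2%:R * v i m j + v i m k + v i m l)
    + 2%:R * c i m j k + 2%:R * c i m j l + c i m k l = 0.
Proof.
move=> U; have ji : j != i by move: U; rewrite /= !inE eq_sym !negb_or; case: eqP.
have := face_moment m ji; rewrite !(sum_ord4_neq _ U) !c0.
rewrite (ct _ _ k j) (ct _ _ l j) (ct _ _ l k) => <-.
by field.
Qed.


Lemma notin_pair (i m n : 'I_4) : i != m -> i != n -> i \notin [:: m; n].
Proof. by move=> im jn; rewrite !inE negb_or im. Qed.

(** The bubble coefficients of the entry [(i, i)] vanish on the edges of face
    [i], and then the three moments force its vertex values to vanish. *)
Lemma normal_normal_face i j k l : uniq [:: i; j; k; l] ->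
  v i i j = 0 /\ c i i j k = 0.
Proof.
move=> U; have := U; rewrite /= !inE !negb_or => /andP[/and3P[ij ik il] _].
have U1 := uniq4_swap23 U.
have U2 := uniq4_swap23 (uniq4_swap34 U).
have := face_moment_distinct i U.
have := face_moment_distinct i U1.
have := face_moment_distinct i U2.
rewrite !c_edge ?notin_pair//.
lra.
Qed.

(** Each of the faces [i] and [j] gives three equations. Those of face [i]
    determine the values at [j], [k] and [l] from the bubble coefficients
    [c i j j k] and [c i j j l]; those of face [j] determine the values at [k]
    and [l] by the same formula from [c i j i k] and [c i j i l]. The formula can
    be inverted, so the coefficients agree. *)
Lemma tangential_faces i j k l : uniq [:: i; j; k; l] ->
  [/\ c i j k l = 0, c i j i k = c i j j k &
      20%:R * v i j k = c i j j l - 3%:R * c i j j k].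
Proof.
move=> U; have := U; rewrite /= !inE !negb_or !andbT.
move=> /and3P[/and3P[ij ik il] /andP[jk jl] kl].
have ckl : c i j k l = 0 by rewrite c_edge ?notin_pair.
have Ui1 := uniq4_swap23 U.
have Ui2 := uniq4_swap23 (uniq4_swap34 U).
have Uj := uniq4_swap12 U.
have Uj1 := uniq4_swap23 (uniq4_swap12 U).
have Uj2 := uniq4_swap23 (uniq4_swap34 (uniq4_swap12 U)).
have fj := face_moment_distinct j U.
have fk := face_moment_distinct j Ui1.
have fl := face_moment_distinct j Ui2.
have fi' := face_moment_distinct i Uj.
have fk' := face_moment_distinct i Uj1.
have fl' := face_moment_distinct i Uj2.
move: fj fk fl fi' fk' fl'.
rewrite !(cC j i) !(vC j i) (ct _ _ k j) (ct _ _ l j) (ct _ _ k i) (ct _ _ l i).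
rewrite (ct _ _ l k) ckl mulr0 !addr0 => fj fk fl fi' fk' fl'.
have [vk vl] := moments_determine_values fj fk fl.
have [vk' vl'] := moments_determine_values fi' fk' fl'.
have ek : c i j j l - 3%:R * c i j j k = c i j i l - 3%:R * c i j i k.
  by rewrite -vk -vk'.
have el : c i j j k - 3%:R * c i j j l = c i j i k - 3%:R * c i j i l.
  by rewrite -vl -vl'.
by move=> {fj fk fl fi' fk' fl' vk' vl' vl}; split=> //; lra.
Qed.

(** With [p i j k := c i j j k], symmetric in [i, j] and skew in [j, k]:
    [p i j k = - p i k j = - p k i j = p k j i = p j k i = - p j i k = - p i j k].
    *)
Lemma mixed_coef_eq0 i j k l : uniq [:: i; j; k; l] -> c i j j k = 0.
Proof.
have sym i' j' k' l' : uniq [:: i'; j'; k'; l'] -> c i' j' j' k' = c j' i' i' k'.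
  by move=> U; have [_ <- _] := tangential_faces U; rewrite cC.
have skew i' j' k' l' : uniq [:: i'; j'; k'; l'] ->
    c i' j' j' k' = - c i' k' k' j'.
  move=> U; have [_ nn] := normal_normal_face U.
  have U1 := uniq4_swap23 (uniq4_swap34 U).
  have [cl _ _] := tangential_faces U1.
  have := c_sum i' j' k'; rewrite (sum_ord4 _ U) nn cl (ct _ k').
  lra.
move=> U.
have U1 := uniq4_swap23 U.
have U2 := uniq4_swap12 (uniq4_swap23 U).
have U3 := uniq4_swap12 (uniq4_swap23 (uniq4_swap12 U)).
have U4 := uniq4_swap23 (uniq4_swap12 U).
have U5 := uniq4_swap12 U.
have := skew _ _ _ _ U; have := sym _ _ _ _ U1; have := skew _ _ _ _ U2.
have := sym _ _ _ _ U3; have := skew _ _ _ _ U4; have := sym _ _ _ _ U5.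
lra.
Qed.

Lemma off_diagonal_coefs i j k l : uniq [:: i; j; k; l] ->
  [/\ v i j i = 0, v i j k = 0, c i j i k = 0, c i j j k = 0 & c i j k l = 0].
Proof.
move=> U; have [ckl cik vk] := tangential_faces U.
have cjk := mixed_coef_eq0 U.
have U1 := uniq4_swap34 U.
have U2 := uniq4_swap12 U.
have [_ _ vl] := tangential_faces U1.
have cjl := mixed_coef_eq0 U1.
have [_ cjl' _] := tangential_faces U1.
split=> //; last by rewrite cik.
- have := face_moment_distinct i U2.
  rewrite !(cC j i) !(vC j i) ckl cik cjl' cjk cjl; lra.
- by lra.
Qed.

Lemma quadratic_off_diagonal i j (w : 'I_4 -> R) : i != j ->
  barycentric_quadratic (v i j) (c i j) w = c i j i j * (w i * w j).
Proof.
move=> /ord4_complete[k [l U]].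
have U1 := uniq4_swap34 U.
have U2 := uniq4_swap12 U.
have [vi vk cik cjk ckl] := off_diagonal_coefs U.
have [_ vl cil cjl _] := off_diagonal_coefs U1.
have [vj _ _ _ _] := off_diagonal_coefs U2.
rewrite /barycentric_quadratic !(sum_ord4 _ U) !c0.
rewrite (ct _ _ j i) (ct _ _ k i) (ct _ _ l i) (ct _ _ k j) (ct _ _ l j).
rewrite (ct _ _ l k) (vC i j j) vi vj vk vl cik cjk cil cjl ckl.
by field.
Qed.
End IndexAlgebra.

(** * Normals, face moments and unisolvence *)

Lemma sum_lift (V : zmodType) (F : 'I_4 -> V) (i : 'I_4) :
  \sum_(l < 3) F (lift i l) = \sum_(m | m != i) F m.
Proof.
apply: (addrI (F i)); transitivity (\sum_m F m); last by rewrite (bigD1 i).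
by rewrite [RHS](bigD1_ord i).
Qed.

Lemma det_gram_ge0 (R : realDomainType) (S : 'M[R]_(3, 2)) :
  0 <= \det (S^T *m S).
Proof.
pose m (k l : 'I_3) := S k 0 * S l 1 - S l 0 * S k 1.
have -> : \det (S^T *m S) = m 0 1 ^+ 2 + m 0 2 ^+ 2 + m 1 2 ^+ 2.
  rewrite (expand_det_row _ 0) !big_ord_recl big_ord0 /cofactor !det_mx11 !mxE.
  rewrite !big_ord_recl !big_ord0 !mxE /m.
  have r1 : lift ord0 ord0 = 1 :> 'I_3 by exact/val_inj.
  have r2 : lift ord0 (lift ord0 ord0) = 2 :> 'I_3 by exact/val_inj.
  have c1 : lift ord0 ord0 = 1 :> 'I_2 by exact/val_inj.
  have c10 : lift (lift ord0 ord0) 0 = 0 :> 'I_2 by exact/val_inj.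
  rewrite r1 r2 c10 c1 /= expr0 expr1.
  have -> : ord0 = 0 :> 'I_3 by [].
  have -> : ord0 = 0 :> 'I_2 by [].
  ring.
by rewrite !addr_ge0// sqr_ge0.
Qed.

(** The denominator is the height of the tetrahedron over face [i], with a minus
    sign as the normal points outwards. *)
Definition gradient (R : realType) (a n : 'I_4 -> 'cV[R]_3) (i : 'I_4) :
    'cV[R]_3 :=
  (dot (n i) (a i - a (lift i ord0)))^-1 *: n i.

Section OutwardNormals.
Variables (R : realType) (a n : 'I_4 -> 'cV[R]_3).
Hypothesis n_normal : forall i, is_outward_unit_normal a i (n i).

Lemma height_neq0 i : dot (n i) (a i - a (lift i ord0)) != 0.
Proof.
have [_ _ n_out] := n_normal i; rewrite lt_eqF//; apply: n_out.
exact: (hull_vertex (face_vertices a i)).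
Qed.

(** The normal [n i] pairs to the same value with all vertices other than [i]. *)
Lemma gradient_dual i k l :
  dot (gradient a n i) (a k - a l) = (i == k)%:R - (i == l)%:R.
Proof.
have [_ n_orth _] := n_normal i; have h0 := height_neq0 i.
have on_face m : m != i -> face a i (a m).
  move=> mi; have [m' ->] : exists m', m = lift i m'.
    by case: (unliftP i m) mi => [m' ->|->]; [exists m'|rewrite eqxx].
  exact: (hull_vertex (face_vertices a i)).
have same m : m != i -> dot (n i) (a m) = dot (n i) (a (lift i ord0)).
  move=> mi; apply/eqP; rewrite -subr_eq0 -dotBr; apply/eqP; apply: n_orth.
    exact: on_face.
  by apply: on_face; rewrite eq_sym neq_lift.
rewrite dotZl; have [<-|ik] := eqVneq i k; have [<-|il] := eqVneq i l.
- by rewrite [dot _ (a i - a i)]dotBr !subrr mulr0.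
- rewrite subr0 -(mulVf h0); congr (_ * _).
  by rewrite !dotBr (same l) // eq_sym.
- rewrite sub0r -(mulVf h0) -mulrN; congr (_ * _).
  by rewrite !dotBr (same k) 1?eq_sym// opprB.
- rewrite [dot _ (a k - a l)]dotBr (same k) 1?eq_sym// (same l) 1?eq_sym//.
  by rewrite !subrr mulr0.
Qed.

(** The gradients of the two remaining vertices of the face provide a left
    inverse of its edge matrix. *)
Lemma det_gram_gt0 i :
  0 < \det ((spread (face_vertices a i))^T *m spread (face_vertices a i)).
Proof.
set S := spread _; pose N : 'M[R]_(2, 3) :=
  \matrix_l (gradient a n (lift i (lift ord0 l)))^T.
have NS : N *m S = 1%:M.
  apply/matrixP => l m; rewrite !mxE.
  transitivity (dot (gradient a n (lift i (lift ord0 l)))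
      (a (lift i (lift ord0 m)) - a (lift i ord0))).
    by rewrite dotE; apply: eq_bigr => k _; rewrite !mxE.
  by rewrite gradient_dual !(inj_eq lift_inj) subr0.
have det_neq0 : \det (S^T *m S) != 0.
  apply/det0P => -[y y0 yS]; move/eqP: y0; apply.
  have Sy0 : S *m y^T = 0.
    apply: dot_eq0; rewrite /dot trmx_mul trmxK -mulmxA [in X in _ *m X]mulmxA.
    by rewrite mulmxA yS mul0mx mxE.
  by apply: trmx_inj; rewrite trmx0 -[y^T]mul1mx -NS -mulmxA Sy0 mulmx0.
by rewrite lt_neqAle eq_sym det_neq0 det_gram_ge0.
Qed.
End OutwardNormals.

(** The degree of freedom is tested against the barycentric coordinate of vertex
    [r] times the direction [g j], rescaled to turn [n i] into [g i]; the
    integrand on the reference triangle is then the entry [(i, j)] times a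
    coordinate. *)
Lemma face_moment_zero (R : realType) (a n : 'I_4 -> 'cV[R]_3)
    (n_normal : forall i, is_outward_unit_normal a i (n i))
    (sigma : 'cV[R]_3 -> 'M[R]_3) (sigma_in : Sigma a sigma)
    (face_dofs : forall (i : 'I_4) (v : 'cV[R]_3 -> 'cV[R]_3),
       polyfun 1 (face a i) setT v ->
       triangle_integral (face_vertices a i)
         (fun x => dot (sigma x *m n i) (v x)) = 0)
    (i j r : 'I_4) : r != i ->
  let q := frame_entry (gradient a n) sigma i j in
  let c m l := edge_bubble q (a m) (a l) in
  5%:R * (\sum_(m | m != i) q (a m) + q (a r)) + \sum_(m | m != i) c r m
  + 2^-1 * (\sum_(m | m != i) \sum_(l | l != i) c m l) = 0.
Proof.
move=> ri q c; have g_dual := gradient_dual n_normal.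
pose g := gradient a n; pose b := face_vertices a i.
have [s rs] : exists s, r = lift i s.
  by case: (unliftP i r) ri => [s ->|->]; [exists s|rewrite eqxx].
pose h := dot (n i) (a i - a (lift i ord0)).
have h0 : h != 0 := height_neq0 n_normal i.
have nE : n i = h *: g i by rewrite /g /gradient scalerA divff// scale1r.
have v_poly : polyfun 1 (face a i) setT
    (fun x => barycentric_coord a g r x *: (h^-1 *: g j)).
  rewrite (_ : (fun x => _) = fun x =>
      (dot (g r) x + (1 - dot (g r) (a r))) *: (h^-1 *: g j)).
    exact: affine_polyfun1.
  by apply/funext => x; congr (_ *: _); rewrite /barycentric_coord dotBr; ring.
have := face_dofs i _ v_poly; rewrite /triangle_integral => /eqP.
rewrite mulf_eq0 sqrtr_eq0 leNgt (det_gram_gt0 n_normal)/= => /eqP int0.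
have lam_b l : barycentric_coord a g r (b l) = (s == l)%:R.
  by rewrite rs -(inj_eq (@lift_inj _ i)); exact: barycentric_coord_vertex.
have bh l : hull a (b l) := hull_vertex a (lift i l).
have : \int[(@lebesgue_measure R \x @lebesgue_measure R)%E]_(p in
      @reference_triangle R)
    (barycentric_quadratic (fun l => q (b l)) (fun l m => edge_bubble q (b l) (b m))
      (fun l => triangle_coord l p) * triangle_coord s p) = 0.
  rewrite -[RHS]int0; apply: eq_Rintegral.
  move=> p /set_mem pT; rewrite triangle_parametrization -/b.
  have xh : hull a (\sum_l triangle_coord l p *: b l).
    apply: (hull_convex g_dual) => //; last exact: triangle_coord_sum.
    by move=> l; exact: triangle_coord_ge0.
  rewrite -(stress_quadratic g_dual sigma_in) ?triangle_coord_sum//; last first.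
    by move=> l; exact: triangle_coord_ge0.
  have -> : barycentric_coord a g r (\sum_l triangle_coord l p *: b l) =
      triangle_coord s p.
    rewrite barycentric_coord_affine ?triangle_coord_sum// (bigD1 s)//=.
    rewrite lam_b eqxx mul1r big1 ?addr0// => l ls.
    by rewrite lam_b eq_sym (negbTE ls) mul0r.
  set x := \sum_l _ in xh *.
  have swap : dot (sigma x *m g i) (g j) = dot (g i) (sigma x *m g j).
    by rewrite [RHS]dot_mulmx (sigma_sym sigma_in xh).
  have -> : sigma x *m n i = h *: (sigma x *m g i) by rewrite nE scalemxAr.
  rewrite [dot _ (_ *: (_ *: _))]dotZr [dot _ (h^-1 *: _)]dotZr.
  rewrite [dot (h *: _) _]dotZl swap.
  by rewrite mulKf// mulrC.
rewrite integral_quadratic_triangle_coord; first last.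
- by move=> l; exact: edge_bubble_diag.
- by move=> l m; exact: edge_bubbleC.
move=> /eqP; rewrite mulf_eq0 invr_eq0 pnatr_eq0 orbF => /eqP.
move=> momentE; rewrite rs -!sum_lift -[RHS]momentE.
by congr (_ + _ * _); apply: eq_bigr => l _; rewrite -sum_lift.
Qed.

Theorem theorem3p2 (R : realType) (a : 'I_4 -> 'cV[R]_3)
    (a_nondeg : nondegenerate_tetrahedron a)
    (n : 'I_4 -> 'cV[R]_3)
    (n_normal : forall i, is_outward_unit_normal a i (n i))
    (sigma : 'cV[R]_3 -> 'M[R]_3)
    (sigma_in : Sigma a sigma)
    (face_dofs : forall (i : 'I_4) (v : 'cV[R]_3 -> 'cV[R]_3),
       polyfun 1 (face a i) setT v ->
       triangle_integral (face_vertices a i)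
         (fun x => dot (sigma x *m n i) (v x)) = 0)
    (volume_dofs : volume_integral (hull a) sigma = 0) :
  forall x, hull a x -> sigma x = 0.
Proof.
have g_dual := gradient_dual n_normal; pose g := gradient a n.
pose q := frame_entry g sigma; pose c := frame_bubble a g sigma.
pose vol i j := \int[((@lebesgue_measure R \x @lebesgue_measure R)
    \x @lebesgue_measure R)%E]_(p in @point3 R @^-1` hull a)
  (barycentric_coord a g i (point3 p) * barycentric_coord a g j (point3 p)).
have ah m : hull a (a m) := hull_vertex a m.
have qE i j x : i != j -> hull a x -> q i j x =
    c i j i j * (barycentric_coord a g i x * barycentric_coord a g j x).
  move=> ij hx; rewrite /q /frame_entry (stress_barycentric g_dual sigma_in)//.
  apply: (@quadratic_off_diagonal _ (fun i j m => q i j (a m)) c) => //.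
  - by move=> i' j' m; rewrite /= /q (frame_entryC g sigma_in).
  - by move=> i' j' m l; exact: (frame_bubbleC g_dual sigma_in).
  - by move=> i' j' m l; exact: edge_bubbleC.
  - by move=> i' j' m; exact: edge_bubble_diag.
  - by move=> i' m l; exact: (frame_bubble_sum g_dual).
  - by move=> i' j' m l; exact: (frame_bubble_edge g_dual sigma_in).
  - move=> i' j' r ri.
    exact: (face_moment_zero n_normal sigma_in face_dofs j' ri).
have gamma0 i j : i != j -> c i j i j = 0.
  move=> ij; have : c i j i j * vol i j = 0.
    rewrite /vol -RintegralZl; last 2 first.
    - exact: measurable_hull.
    - exact: (integrable_barycentric_coord2 g_dual).
    rewrite -[RHS](integral_frame_entry g_dual sigma_in i j volume_dofs).
    by apply: eq_Rintegral => p /set_mem hp; exact/esym/qE.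
  have /negbTE vol0 := integral_barycentric_coord2_neq0 g_dual i j.
  by move=> /eqP; rewrite mulf_eq0 vol0 orbF => /eqP.
move=> x hx; apply: (frame_bilinear_eq0 g_dual) => i j ij.
by have := qE i j x ij hx; rewrite gamma0// mul0r.
Qed.
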